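(* Let $M$ be a prime and let $q$ be a power of $M$. Then: (1) For all $n\geq 1$, $c(n,q,M)_{\mathrm{ss}}=c(n,q)_{\mathrm{ss}}$. The generating function for the semisimple classes (respectively semisimple elements) which are $M$-th powers is the same as that of all semisimple classes (respectively all semisimple elements); that is, $$1+\sum_{n\ge1}c(n,q,M)_{\mathrm{ss}}u^n=1+\sum_{n\geq 1}c(n,q)_{\mathrm{ss}}u^n,\qquad 1+\sum_{n\ge1}\frac{|\mathrm{GL}(n,q)^M_{\mathrm{ss}}|}{|\mathrm{GL}(n,q)|}u^n=1+\sum_{n\ge1}\frac{|\mathrm{GL}(n,q)_{\mathrm{ss}}|}{|\mathrm{GL}(n,q)|}u^n.$$ (2) For all $n\geq 1$, $c(n,q,M)_{\mathrm{rg}}=c(n,q,M)_{\mathrm{rs}}=c(n,q)_{\mathrm{rs}}$. The generating functions for the regular and for the regular semisimple classes (respectively elements) which are $M$-th powers are both the same as that of all regular semisimple classes (respectively all regular semisimple elements); that is, $$1+\sum_{n\ge1}c(n,q,M)_{\mathrm{rg}}u^n=1+\sum_{n\ge1}c(n,q,M)_{\mathrm{rs}}u^n=1+\sum_{n\ge1}c(n,q)_{\mathrm{rs}}u^n,$$ $$1+\sum_{n\ge1}\frac{|\mathrm{GL}(n,q)^M_{\mathrm{rg}}|}{|\mathrm{GL}(n,q)|}u^n=1+\sum_{n\ge1}\frac{|\mathrm{GL}(n,q)^M_{\mathrm{rs}}|}{|\mathrm{GL}(n,q)|}u^n=1+\sum_{n\ge1}\frac{|\mathrm{GL}(n,q)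_{\mathrm{rs}}|}{|\mathrm{GL}(n,q)|}u^n.$$
   Context: $\mathrm{GL}(n,q)$ is the group of invertible $n\times n$ matrices over the field $\mathbb F_q$ with $q$ elements. Let $\Phi$ be the set of monic irreducible polynomials of degree $\geq 1$ over $\mathbb F_q$ other than $x$. The conjugacy class of $\alpha\in\mathrm{GL}(n,q)$ is determined by its combinatorial data: distinct $f_1,\dots,f_l\in\Phi$ with non-empty partitions $\lambda_{f_i}=(\lambda_{i_1},\lambda_{i_2},\dots)$ satisfying $\sum_i|\lambda_{f_i}|\deg f_i=n$, meaning that the $\mathbb F_q[x]$-module $\mathbb F_q^n$ defined by $\alpha$ is isomorphic to $\bigoplus_{i,j}\mathbb F_q[x]/(f_i^{\lambda_{i_j}})$. The element $\alpha$ (and its class) is regular (rg) if every $\lambda_{f_i}$ has a single part, semisimple (ss) if all parts of all $\lambda_{f_i}$ equal $1$, and regular semisimple (rs) if every $\lambda_{f_i}=(1)$. For $*\in\{\mathrm{rg},\mathrm{rs},\mathrm{ss}\}$: $\mathrm{GL}(n,q)_*$ is the set of elements of type $*$ and $c(n,q)_*$ the number of conjugacy classes of type $*$ in $\mathrm{GL}(n,q)$; $\mathrm{GL}(n,q)^M_*$ is the set of elements of type $*$ in the image of the power map $x\mapsto x^M$ on $\mathrm{GL}(n,q)$, and $c(n,q,M)_*$ is the number of conjugacy classes of type $*$ contained in this image. *)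

(* Defs.v *)
From HB Require Import structures.
From mathcomp Require Import all_boot all_order all_algebra all_fingroup.
From mathcomp Require Import boolp.

Set Implicit Arguments.
Unset Strict Implicit.
Unset Printing Implicit Defensive.

Import GRing.Theory.
Local Open Scope ring_scope.

(* Conventions: F is a finite field, #|F| = q, and GL(n, q) is 'GL_n[F].
   The underlying matrices of {'GL_n[F]} have size n.-1.+1, so 'GL_n[F] is the
   group of n x n matrices only for n > 0; nothing is asserted for n = 0. *)

Section Types.

Variable F : finFieldType.

Definition in_Phi (f : {poly F}) : Prop :=
  [/\ f \is monic, irreducible_poly f & f != 'X].

Definition is_partition (l : seq nat) : bool := sorted geq l && (0%N \notin l).

(* Combinatorial data: the list of pairs (f_i, lambda_{f_i}). *)
Definition data := seq ({poly F} * seq nat).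

Definition valid_data (n : nat) (d : data) : Prop :=
  [/\ uniq (map fst d),
      forall f l, (f, l) \in d -> [/\ in_Phi f, is_partition l & l != [::]]
    & (\sum_(fl <- d) sumn fl.2 * (size fl.1).-1)%N = n].

(* The list of all f_i ^ lambda_{i_j}. *)
Definition elementary_divisors (d : data) : seq {poly F} :=
  flatten [seq [seq fl.1 ^+ k | k <- fl.2] | fl <- d].

(* The underlying type of the direct sum of the F[x]/(g), g in gs. It is only
   used when every g is monic of positive degree: otherwise {poly %/ g} is not
   F[x]/(g). *)
Definition dsum_quot (gs : seq {poly F}) : Type :=
  {dffun forall i : 'I_(size gs), {poly %/ gs`_i}}.

(* phi is an isomorphism of F[x]-modules from F^n, on which p acts as p(A), to
   the direct sum of the F[x]/(g), on which p acts by multiplication by p. *)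
Definition module_iso (n : nat) (A : 'M[F]_n.+1) (gs : seq {poly F})
    (phi : 'cV[F]_n.+1 -> dsum_quot gs) : Prop :=
  [/\ bijective phi,
      forall u v i, phi (u + v) i = phi u i + phi v i
    & forall (p : {poly F}) v i,
        phi (horner_mx A p *m v) i = in_qpoly gs`_i p * phi v i].

Definition has_data (n : nat) (a : {'GL_n[F]}) (d : data) : Prop :=
  valid_data n d /\
  exists phi : 'cV[F]_n.-1.+1 -> dsum_quot (elementary_divisors d),
    module_iso (GLval a) phi.

Inductive eltype := rg | rs | ss.

Definition partition_of_type (t : eltype) (l : seq nat) : bool :=
  match t with
  | rg => size l == 1%N
  | rs => l == [:: 1%N]
  | ss => all (pred1 1%N) l
  end.

(* The data of a are unique up to reordering, so "exists" loses nothing. *)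
Definition of_type (t : eltype) (n : nat) (a : {'GL_n[F]}) : Prop :=
  exists2 d, has_data a d & all (partition_of_type t) (map snd d).

End Types.

Section Counting.

Variables (F : finFieldType) (t : eltype) (n : nat).

Definition GLt : {set {'GL_n[F]}} := [set a | `[< of_type t a >]].

Definition power_image (M : nat) : {set {'GL_n[F]}} :=
  [set (a ^+ M)%g | a in 'GL_n[F]%g].

Definition GLtM (M : nat) : {set {'GL_n[F]}} := GLt :&: power_image M.

(* Being of a given type is a class property, so the classes of type t are
   those contained in GLt. *)
Definition c_t : nat := #|[set C in classes 'GL_n[F]%g | C \subset GLt]|.

Definition c_tM (M : nat) : nat :=
  #|[set C in classes 'GL_n[F]%g |
      (C \subset GLt) && (C \subset power_image M)]|.

Definition proportion (A : {set {'GL_n[F]}}) : rat := #|A|%:R / #|'GL_n[F]%g|%:R.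

End Counting.

(* The formal power series 1 + \sum_(n >= 1) a n u^n over the rationals,
   represented by its sequence of coefficients. *)
Definition gen_series (a : nat -> rat) : nat -> rat :=
  fun n => if n == 0%N then 1 else a n.

(* Main.v *)
Require Import Defs.
From mathcomp Require Import all_boot all_order all_algebra all_fingroup.
From mathcomp Require Import cyclic finfield qpoly boolp.

(** Let A be an invertible matrix over a field of characteristic M, and regard
the column space as an F[x]-module on which x acts by A.  All the equalities
follow from three facts about A, since the sets and classes being counted are
determined by the sets of elements of each type and by the image of the M-th
power map.

A semisimple A is an M-th power ([of_type_ss_power]).  The module is a direct
sum of fields F[x]/(f), so p(A)^N = 0 implies p(A) = 0
([of_type_ss_reduced]).  Write the order of A as m M^e with m prime to M.  In
characteristic M, (A^m - 1)^(M^e) = A^(m M^e) - 1 = 0, hence A^m = 1: the order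
of A is prime to M, and the M-th power map is a bijection of the cyclic group
generated by A.

A regular semisimple element is semisimple and regular
([of_type_rs_ss], [of_type_rs_rg]).

A regular A = B^M is regular semisimple ([of_type_rg_power]).  The summands
F[x]/(f^k) have pairwise coprime moduli, so B, which commutes with A, maps the
generator e of such a summand into that summand: B e = p(A) e for some
polynomial p.  Then A e = B^M e = p(A)^M e, so f^k divides x - p^M
([power_dvdp_Xsub_exp]).  The derivative of x - p^M is 1 in characteristic M,
so x - p^M is squarefree ([sqr_irredp_ndvdp_Xsub_exp]), and k = 1. *)

Set Implicit Arguments.
Unset Strict Implicit.
Unset Printing Implicit Defensive.

Import GRing.Theory.
Local Open Scope ring_scope.

(** * Irreducible polynomials *)

Section IrreduciblePoly.

Variable F : fieldType.

Lemma irredp_dvdp_exp (f p : {poly F}) N :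
  irreducible_poly f -> f %| p ^+ N -> f %| p.
Proof.
move=> irr_f; apply: contraLR.
by rewrite -!irreducible_poly_coprime //; apply: coprimep_expr.
Qed.

Lemma irredp_monic_coprime (f g : {poly F}) :
  f \is monic -> g \is monic -> irreducible_poly f -> irreducible_poly g ->
  f != g -> coprimep f g.
Proof.
move=> mf mg irr_f irr_g; apply: contraR.
rewrite irreducible_poly_coprime // negbK -eqp_monic // => f_dv_g.
by apply: irr_g => //; rewrite gtn_eqF // irr_f.
Qed.

(** The hypotheses make [mk_monic g] equal to g: otherwise [{poly %/ g}] is a
quotient by 'X. *)
Lemma in_qpoly_eq0 (g p : {poly F}) :
  g \is monic -> (1 < size g)%N -> (in_qpoly g p == 0) = (g %| p).
Proof.
move=> mg sg; rewrite -val_eqE /= /mk_monic sg mg /=.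
by rewrite -Pdiv.IdomainMonic.modpE.
Qed.

Lemma in_qpolyK (g : {poly F}) (w : {poly %/ g}) : in_qpoly g (polyn w) = w.
Proof. exact/val_inj/in_qpoly_small/size_mk_monic. Qed.

(** A square divisor f ^+ 2 of 'X - p ^+ M would force f to divide its derivative,
which is 1 in characteristic M. *)
Lemma sqr_irredp_ndvdp_Xsub_exp (f p : {poly F}) M :
  M \in [pchar F] -> irreducible_poly f -> ~~ (f ^+ 2 %| 'X - p ^+ M).
Proof.
move=> pcharM irr_f; apply/dvdpP => -[q Dq].
have: f %| ('X - p ^+ M)^`().
  rewrite Dq derivM expr2 derivM.
  rewrite [f * f^`()]mulrC -mulr2n -mulrnAl !mulrA.
  by rewrite dvdp_add ?dvdp_mull.
have pM : M \in [pchar {poly F}] by rewrite pchar_poly.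
rewrite derivB derivX deriv_exp -mulr_natl (pcharf0 pM) mul0r subr0.
by rewrite dvdp1 gtn_eqF // irr_f.
Qed.

End IrreduciblePoly.

(** * Matrices acting on a direct sum of cyclic modules *)

Section ModuleIso.

Variables (F : finFieldType) (n : nat) (A : 'M[F]_n.+1) (gs : seq {poly F}).
Variable phi : 'cV[F]_n.+1 -> dsum_quot gs.
Hypothesis isoA : module_iso A phi.
Hypothesis monic_gs : forall i : 'I_(size gs), gs`_i \is monic.
Hypothesis gs_gt1 : forall i : 'I_(size gs), (1 < size (gs`_i)%R)%N.

Lemma module_iso0 i : phi 0 i = 0.
Proof.
have [_ phiD _] := isoA.
by apply: (addrI (phi 0 i)); rewrite -phiD !addr0.
Qed.

Lemma module_iso_inj u v : (forall i, phi u i = phi v i) -> u = v.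
Proof.
have [phi_bij _ _] := isoA => eq_uv.
by apply: (bij_inj phi_bij); apply/ffunP.
Qed.

Lemma module_iso_surj (w : forall i : 'I_(size gs), {poly %/ gs`_i}) :
  exists u, forall i, phi u i = w i.
Proof.
have [[psi _ psiK] _ _] := isoA.
by exists (psi (finfun w)) => i; rewrite psiK ffunE.
Qed.

Lemma horner_mx_eq0 p :
  reflect (horner_mx A p = 0) [forall i : 'I_(size gs), gs`_i %| p].
Proof.
have [_ _ phiM] := isoA; apply: (iffP forallP) => [dv_p | pA0 i].
  apply/matrixP => r c.
  have Dcol: horner_mx A p *m delta_mx c 0 = 0 :> 'cV_n.+1.
    apply: module_iso_inj => i; rewrite phiM module_iso0.
    by have /eqP-> := etrans (in_qpoly_eq0 p (monic_gs i) (gs_gt1 i)) (dv_p i);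
       rewrite mul0r.
  by move/matrixP/(_ r 0): Dcol; rewrite -colE !mxE.
(* The element (1, ..., 1) of the direct sum has annihilator the intersection of
   the ideals generated by the elements of gs. *)
have [u Du] := module_iso_surj (fun=> 1).
by rewrite -in_qpoly_eq0 // -[in_qpoly _ p]mulr1 -(Du i) -phiM pA0 mul0mx
           module_iso0.
Qed.

(** The i-th summand is the part of the module killed by gs`_i, since the other
moduli are coprime to gs`_i, so it is stable under every B commuting with A.
As it is cyclic, B acts on its generator as some polynomial p in A, and then
B ^+ M acts there as p ^+ M. *)
Lemma power_dvdp_Xsub_exp M (B : 'M[F]_n.+1) (i : 'I_(size gs)) :
    (forall j, j != i -> coprimep gs`_j gs`_i) -> B ^+ M = A ->
  exists p, gs`_i %| 'X - p ^+ M.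
Proof.
have [_ _ phiM] := isoA; move=> co_i defA.
have cAB: GRing.comm A B by rewrite -defA; apply/commr_sym/commrX.
have [e De] := module_iso_surj (fun j => (j == i)%:R).
pose p : {poly F} := polyn (phi (B *m e) i).
have DBe: B *m e = horner_mx A p *m e.
  apply: module_iso_inj => j; rewrite phiM De.
  have [-> | ji] := eqVneq j i.
    by rewrite mulr1 in_qpolyK.
  rewrite mulr0.
  (* B e is killed by gs`_i like e, hence so is its j-th component, on which
     gs`_i acts invertibly. *)
  have: horner_mx A gs`_i *m (B *m e) = 0.
    rewrite mulmxA (comm_horner_mx gs`_i cAB) -mulmxA.
    suff ->: horner_mx A gs`_i *m e = 0 by rewrite mulmx0.
    apply: module_iso_inj => l; rewrite phiM De module_iso0.
    have [-> | _] := eqVneq l i; last by rewrite mulr0.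
    by apply/eqP; rewrite mulr1 in_qpoly_eq0.
  move/(congr1 (fun u => phi u j)); rewrite phiM module_iso0.
  rewrite -[phi _ j]in_qpolyK -rmorphM => /eqP.
  rewrite in_qpoly_eq0 // Gauss_dvdpr ?co_i // => dv_w.
  by apply/eqP; rewrite in_qpoly_eq0.
have DBMe N: B ^+ N *m e = horner_mx A (p ^+ N) *m e.
  elim: N => [|N IHN]; first by rewrite !expr0 rmorph1.
  rewrite exprSr -mulmxE -mulmxA DBe mulmxA.
  rewrite -(comm_horner_mx p (commrX N cAB)) -mulmxA IHN mulmxA.
  by rewrite exprS rmorphM.
exists p; rewrite -in_qpoly_eq0 //.
have: horner_mx A ('X - p ^+ M) *m e = 0.
  by rewrite rmorphB /= horner_mx_X mulmxBl -DBMe defA subrr.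
move/(congr1 (fun u => phi u i)).
by rewrite phiM De eqxx mulr1 module_iso0 => ->.
Qed.

End ModuleIso.

(** * Element types and the power map *)

Section Types.

Variables (M : nat) (F : finFieldType).
Hypothesis pcharM : M \in [pchar F].

Lemma mem_elementary_divisors (d : data F) g :
  reflect (exists f l k, [/\ (f, l) \in d, k \in l & g = f ^+ k])
          (g \in elementary_divisors d).
Proof.
apply: (iffP flatten_mapP).
  case=> -[f l] dfl /mapP[k lk ->].
  by exists f, l, k.
case=> f [l [k [dfl lk ->]]].
by exists (f, l) => //; apply: map_f.
Qed.

Lemma elementary_divisor_monic n (d : data F) g :
  valid_data n d -> g \in elementary_divisors d ->
  g \is monic /\ (1 < size g)%N.
Proof.
case=> _ dP _ /mem_elementary_divisors[f [l [k [dfl lk ->]]]].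
have [[mf irr_f _] /andP[_ l_gt0] _] := dP _ _ dfl.
split; first exact: monic_exp.
rewrite -subn_gt0 subn1 size_exp muln_gt0 -subn1 subn_gt0 irr_f.
by rewrite lt0n; apply: contraNneq l_gt0 => <-.
Qed.

(** The algebra F[a] has no nonzero nilpotent element, being embedded in a product of
fields. *)
Lemma of_type_ss_reduced n (a : {'GL_n[F]}) p N :
  of_type ss a -> horner_mx (GLval a) (p ^+ N) = 0 -> horner_mx (GLval a) p = 0.
Proof.
case=> d [dP [phi isoA]] /allP ss_d.
have edP (i : 'I_(size (elementary_divisors d))) :=
  elementary_divisor_monic dP (mem_nth 0 (ltn_ord i)).
have m_ed i := (edP i).1; have gt1_ed i := (edP i).2.
move/(horner_mx_eq0 isoA m_ed gt1_ed)/forallP => dv_pN.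
apply/(horner_mx_eq0 isoA m_ed gt1_ed)/forallP => i.
have := dv_pN i.
have /mem_elementary_divisors[f [l [k [dfl lk Dg]]]] := mem_nth 0 (ltn_ord i).
have [_ /(_ _ _ dfl)[[_ irr_f _] _ _] _] := dP.
have /allP/(_ _ lk)/eqP k1 := ss_d _ (map_f snd dfl).
by rewrite Dg k1 expr1; apply: irredp_dvdp_exp.
Qed.

(** The order of a is prime to M, because in characteristic M unipotent elements
are exactly those of M-power order and F[a] contains no unipotent element
besides 1. *)
Lemma of_type_ss_power n (a : {'GL_n[F]}) :
  of_type ss a -> a \in power_image F n M.
Proof.
have [M_prime _] := andP pcharM => ss_a; set m := (#[a]%g`_M^')%N.
have am1: (a ^+ m = 1)%g.
  apply/val_inj; rewrite FinRing.val_unitX; apply/eqP; rewrite -subr_eq0.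
  have hornerE N: horner_mx (GLval a) ('X^N - 1) = GLval a ^+ N - 1.
    by rewrite rmorphB rmorphXn rmorph1 /= horner_mx_X.
  rewrite -hornerE; apply/eqP/(of_type_ss_reduced (N := (#[a]%g`_M)%N) ss_a).
  have pnatM: [pchar {poly F}].-nat (#[a]%g`_M)%N.
    rewrite (eq_pnat _ (pcharf_eq (_ : M \in [pchar {poly F}]))) ?part_pnat //.
    by rewrite pchar_poly.
  (* By Frobenius, the power of 'X^m - 1 is 'X^#[a] - 1. *)
  rewrite exprDn_pchar // exprNn_pchar // expr1n -exprM mulnC partnC //.
  by rewrite hornerE -[GLval a]/(val a) -FinRing.val_unitX expg_order subrr.
have coaM: coprime #|<[a]>%g| M.
  apply: (@coprime_dvdl _ m); first by rewrite order_dvdn am1.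
  by rewrite coprime_sym prime_coprime // -p'natE // part_pnat.
apply/imsetP; exists (a ^+ expg_invn <[a]> M)%g; rewrite ?inE //.
by rewrite -expgM mulnC expgM expgK ?cycle_id.
Qed.

Lemma of_type_rs_ss n (a : {'GL_n[F]}) : of_type rs a -> of_type ss a.
Proof.
by case=> d dP rs_d; exists d => //; apply: sub_all rs_d => l /eqP->.
Qed.

Lemma of_type_rs_rg n (a : {'GL_n[F]}) : of_type rs a -> of_type rg a.
Proof.
by case=> d dP rs_d; exists d => //; apply: sub_all rs_d => l /eqP->.
Qed.

Lemma elementary_divisors_rg (d : data F) :
  all (partition_of_type rg) (map snd d) ->
  elementary_divisors d = [seq fl.1 ^+ head 0%N fl.2 | fl <- d].
Proof.
rewrite /elementary_divisors; elim: d => //= -[f l] d IHd /andP[l1 /IHd->].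
by case: l l1 => [|k []].
Qed.

Lemma elementary_divisors_rg_coprime n (d : data F) :
  valid_data n d -> all (partition_of_type rg) (map snd d) ->
  forall i j : 'I_(size (elementary_divisors d)), j != i ->
    coprimep (elementary_divisors d)`_j (elementary_divisors d)`_i.
Proof.
case=> uniq_d dP _ rg_d i j ji.
have lt_d (l : 'I_(size (elementary_divisors d))) : (l < size d)%N.
  by case: l => l /=; rewrite elementary_divisors_rg // size_map.
have edE (l : nat) : (elementary_divisors d)`_l
    = [seq fl.1 ^+ head 0%N fl.2 | fl <- d]`_l.
  by rewrite elementary_divisors_rg.
rewrite !edE !(nth_map (0, [::])) //; apply/coprimep_expl/coprimep_expr.
have PhiP (l : 'I_(size (elementary_divisors d))) :
  in_Phi (nth (0, [::]) d l).1.
  by case: (nth _ d l) (mem_nth (0, [::]) (lt_d l)) => f lam /dP[].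
have [mj irr_j _] := PhiP j; have [mi irr_i _] := PhiP i.
apply: irredp_monic_coprime => //.
by rewrite -!(nth_map _ 0 fst) // nth_uniq ?size_map.
Qed.

(** A part k >= 2 would make the square of an irreducible f divide some
'X - p ^+ M. *)
Lemma of_type_rg_power n (a : {'GL_n[F]}) :
  of_type rg a -> a \in power_image F n M -> of_type rs a.
Proof.
move=> [d aP rg_d] /imsetP[b _ Da]; exists d => //.
have [dP [phi isoA]] := aP; have [_ irr_d _] := dP.
have edE := elementary_divisors_rg rg_d.
have edP (i : 'I_(size (elementary_divisors d))) :=
  elementary_divisor_monic dP (mem_nth 0 (ltn_ord i)).
apply/allP => l0 /mapP[[f l] dfl -> /=].
have ltid: (index (f, l) d < size (elementary_divisors d))%N.
  by rewrite edE size_map index_mem.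
pose i := Ordinal ltid; have defA: GLval b ^+ M = GLval a.
  by rewrite Da -[GLval b]/(val b) -FinRing.val_unitX.
have co_i j := elementary_divisors_rg_coprime dP rg_d (i := i) (j := j).
have [p] :=
  power_dvdp_Xsub_exp isoA (fun j => (edP j).1) (fun j => (edP j).2) co_i defA.
have [[_ irr_f _] /andP[_ l_gt0] _] := irr_d _ _ dfl.
rewrite [X in X`_i]edE (nth_map (0, [::])) ?index_mem // nth_index //=.
have /allP/(_ _ (map_f snd dfl)) := rg_d.
case: l l_gt0 {dfl i ltid co_i} => [|[|[|k]] [|//]] //= _ _ f_dv.
have /negP[] := sqr_irredp_ndvdp_Xsub_exp p pcharM irr_f.
by apply: dvdp_trans f_dv; apply: dvdp_exp2l.
Qed.

End Types.

(** * Counting classes and elements *)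

Theorem proposition10p6 (M k : nat) (F : finFieldType)
    (M_prime : prime M) (k_gt0 : (0 < k)%N) (cardF : #|F| = (M ^ k)%N) :
  [/\ forall n, (1 <= n)%N -> c_tM F ss n M = c_t F ss n,
      gen_series (fun n => (c_tM F ss n M)%:R)
        = gen_series (fun n => (c_t F ss n)%:R)
    & gen_series (fun n => proportion (GLtM F ss n M))
        = gen_series (fun n => proportion (GLt F ss n))]
  /\
  [/\ forall n, (1 <= n)%N ->
        c_tM F rg n M = c_tM F rs n M /\ c_tM F rs n M = c_t F rs n,
      gen_series (fun n => (c_tM F rg n M)%:R)
        = gen_series (fun n => (c_tM F rs n M)%:R)
      /\ gen_series (fun n => (c_tM F rs n M)%:R)
        = gen_series (fun n => (c_t F rs n)%:R)
    & gen_series (fun n => proportion (GLtM F rg n M))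
        = gen_series (fun n => proportion (GLtM F rs n M))
      /\ gen_series (fun n => proportion (GLtM F rs n M))
        = gen_series (fun n => proportion (GLt F rs n))].
Proof.
have pcharM: M \in [pchar F] by apply: card_finPcharP cardF M_prime.
have c_tME t n: c_tM F t n M
    = #|[set C in classes 'GL_n[F]%g | C \subset GLtM F t n M]|.
  by apply: eq_card => C; rewrite !inE subsetI.
have ssE n: GLtM F ss n M = GLt F ss n.
  apply/setIidPl/subsetP => a; rewrite inE => /asboolP.
  exact: of_type_ss_power.
have rsE n: GLtM F rs n M = GLt F rs n.
  apply/setIidPl/subsetP => a; rewrite inE => /asboolP/of_type_rs_ss.
  exact: of_type_ss_power.
have rgE n: GLtM F rg n M = GLtM F rs n M.
  apply/setP => a; rewrite !inE; apply/andP/andP => -[/asboolP ta aM].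
    by split=> //; apply/asboolP/(of_type_rg_power pcharM).
  by split=> //; apply/asboolP/of_type_rs_rg.
have ss_c n: c_tM F ss n M = c_t F ss n by rewrite c_tME ssE.
have rs_c n: c_tM F rs n M = c_t F rs n by rewrite c_tME rsE.
have rg_c n: c_tM F rg n M = c_tM F rs n M by rewrite !c_tME rgE.
do 2?split=> //; try split; apply/funext => -[|n] //=; rewrite /gen_series /=.
all: by rewrite ?ss_c ?ssE ?rg_c ?rs_c ?rgE ?rsE.
Qed.
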